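(* Let $M$ be a real symmetric $n\times n$ matrix. The following assertions are equivalent. (i) The program defining $p_M^{(1)}$ is feasible, i.e., $p_M^{(1)}$ is finite. (ii) There exist $\lambda\in\mathbb{R}$ and $a\in\mathbb{R}^n_+$ such that $M-\lambda J-(ae^T+ea^T)/2\succeq0$. (iii) $p_M^{(1)}=p_{\min}$.
   Context: $e$ is the all-ones vector in $\mathbb{R}^n$, $J=ee^T$, and $\succeq0$ means positive semidefinite. $\Delta_n=\{x\in\mathbb{R}^n:x\ge0,\sum_{i=1}^nx_i=1\}$, $p_M(x)=x^TMx$, and $p_{\min}=\min\{p_M(x):x\in\Delta_n\}$. $\Sigma$ is the set of sums of squares of real polynomials in $x=(x_1,\dots,x_n)$. With $\mathcal{M}(x_1,\dots,x_n)_r=\{\sigma_0+\sum_{j=1}^n\sigma_jx_j:\sigma_j\in\Sigma,\ \deg(\sigma_0)\le2r,\ \deg(\sigma_jx_j)\le2r\}$ and $\langle h\rangle_k=\{uh:u\in\mathbb{R}[x],\deg(uh)\le k\}$, define $$p_M^{(1)}=\sup\Big\{\lambda\in\mathbb{R}:p_M-\lambda\in\mathcal{M}(x_1,\dots,x_n)_1+\Big\langle\sum_{i=1}^nx_i-1\Big\rangle_2\Big\},$$ with $\sup\emptyset=-\infty$. *)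

(* Defs.v *)
From HB Require Import structures.
From mathcomp Require Import all_boot all_order all_algebra.
From mathcomp Require Import all_classical all_reals all_analysis.
(* The notations of mpoly and mathcomp-analysis clash, hence the import
   filter; the only one needed here is redeclared below. *)
From mathcomp Require Import -(notations) mpoly.

Set Implicit Arguments.
Unset Strict Implicit.
Unset Printing Implicit Defensive.

Import Order.TTheory GRing.Theory Num.Theory.
Import numFieldNormedType.Exports.

Local Open Scope classical_set_scope.
Local Open Scope ring_scope.

Notation "{ 'mpoly' R [ n ] }" := (mpoly n R) (format "{ 'mpoly'  R [ n ] }").

Section Definitions.
Context {R : realType} {n : nat}.
Implicit Types (M : 'M[R]_n) (p h : {mpoly R[n]}).

Definition ones : 'cV[R]_n := const_mx 1.

Definition psdmx M : Prop :=
  M^T = M /\ forall x : 'cV[R]_n, 0 <= (x^T *m M *m x) 0 0.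

Definition simplex : set 'cV[R]_n :=
  [set x | (forall i, 0 <= x i 0) /\ \sum_i x i 0 = 1].

Definition mvar (i : 'I_n) : {mpoly R[n]} := mpolyX R (mnm1 i).

(* The polynomial x^T M x, as a matrix product over the polynomial ring. *)
Definition quadpoly M : {mpoly R[n]} :=
  let x : 'cV[{mpoly R[n]}]_n := \col_i mvar i in
  (x^T *m map_mx (@mpolyC n R) M *m x) 0 0.

Definition evalp p (x : 'cV[R]_n) : R := meval (fun i => x i 0) p.

(* The infimum is attained, see [pmin_is_min]. *)
Definition pmin M : R := inf [set evalp (quadpoly M) x | x in simplex].

(* deg p <= d: msize p is deg p + 1, and 0 if p = 0. *)
Definition deg_le p (d : nat) : Prop := (msize p <= d.+1)%N.

Definition sos : set {mpoly R[n]} :=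
  [set p | exists s : seq {mpoly R[n]}, p = \sum_(q <- s) q ^+ 2].

Definition quadmod (r : nat) : set {mpoly R[n]} :=
  [set p | exists (s0 : {mpoly R[n]}) (s : 'I_n -> {mpoly R[n]}),
     [/\ sos s0 /\ (forall j, sos (s j)),
         deg_le s0 (2 * r)%N,
         forall j, deg_le (s j * mvar j) (2 * r)%N &
         p = s0 + \sum_j s j * mvar j]].

Definition trideal h (k : nat) : set {mpoly R[n]} :=
  [set p | exists2 u, deg_le (u * h) k & p = u * h].

Definition feasible1 M : set R :=
  [set l | exists q t, [/\ quadmod 1 q, trideal (\sum_i mvar i - 1) 2 t &
                           quadpoly M - mpolyC n l = q + t]].

(* ereal_sup set0 = -oo *)
Definition pM1 M : \bar R := ereal_sup [set l%:E | l in feasible1 M].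

End Definitions.

Arguments ones {R n}.

Lemma evalp_quadpoly (R : realType) (n : nat) (M : 'M[R]_n) (x : 'cV[R]_n) :
  evalp (quadpoly M) x = (x^T *m M *m x) 0 0.
Proof.
rewrite /evalp /quadpoly !mxE raddf_sum; apply: eq_bigr => j _ /=.
rewrite mevalM !mxE /mvar mevalXU; congr (_ * _).
rewrite raddf_sum; apply: eq_bigr => i _ /=.
by rewrite mevalM !mxE /mvar mevalXU mevalC.
Qed.

Lemma pmin_is_min (R : realType) (n : nat) (M : 'M[R]_n) : (0 < n)%N ->
  (exists2 x, simplex x & evalp (quadpoly M) x = pmin M) /\
  (forall x, simplex x -> pmin M <= evalp (quadpoly M) x).
Proof.
case: n M => // n M _.
pose f (v : 'rV[R]_n.+1) : R := \sum_j (\sum_i v 0 i * M i j) * v 0 j.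
have fE x : f x^T = evalp (quadpoly M) x.
  rewrite evalp_quadpoly !mxE; apply: eq_bigr => j _.
  by rewrite !mxE; congr (_ * _).
have sumc (g : 'I_n.+1 -> 'rV[R]_n.+1 -> R) : (forall i, continuous (g i)) ->
    continuous (fun v => \sum_i g i v).
  by move=> gc; apply: continuous_big => // z;
    apply: cvgD; [exact: cvg_fst|exact: cvg_snd].
have cc i : continuous (fun v : 'rV[R]_n.+1 => v 0 i).
  exact: (@coord_continuous _ _ _ 0 i).
have fc : continuous f.
  apply: (sumc (fun j v => (\sum_i v 0 i * M i j) * v 0 j)) => j v.
  have rc : continuous (fun w : 'rV[R]_n.+1 => \sum_i w 0 i * M i j).
    apply: (sumc (fun i w => w 0 i * M i j)) => i w.
    by apply: continuousM; [exact: cc|exact: cst_continuous].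
  by apply: continuousM; [exact: rc|exact: cc].
pose A : set 'rV[R]_n.+1 :=
  [set v | forall i, `[0, 1]%classic (v 0 i)] `&` [set v | \sum_i v 0 i = 1].
have Ac : compact A.
  apply: compact_closedI.
    have := @rV_compact R n.+1 (fun=> `[0, 1]%classic).
    by apply=> i; exact: segment_compact.
  have gc : continuous (fun v : 'rV[R]_n.+1 => \sum_i v 0 i).
    by apply: (sumc (fun i v => v 0 i)) => i; exact: cc.
  exact: ((continuous_closedP _).1 gc _ (@closed_eq R 1)).
have AE x : A x^T <-> simplex x.
  split=> [[h1 h2]|[h1 h2]]; split.
  - by move=> i; have := h1 i; rewrite /= in_itv /= mxE => /andP[].
  - by move: h2 => /= <-; apply: eq_bigr => i _; rewrite mxE.
  - move=> i; rewrite /= in_itv /= mxE h1 /= -h2 (bigD1 i) //=.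
    by rewrite lerDl sumr_ge0.
  - by rewrite /= -h2; apply: eq_bigr => i _; rewrite mxE.
have A0 : A !=set0.
  exists (delta_mx 0 0); rewrite -[delta_mx _ _]trmxK; apply/AE; split.
    by move=> i; rewrite !mxE; case: (_ && _).
  rewrite (bigD1 ord0) //= big1 ?addr0 => [|i /negPf i0]; rewrite !mxE //.
  by rewrite i0.
have [c /set_mem Ac0 cmin] := EVT_min_rV A0 Ac (continuous_subspaceT fc).
have sc : simplex c^T by apply/AE; rewrite trmxK.
have lb x : simplex x -> evalp (quadpoly M) c^T <= evalp (quadpoly M) x.
  by move=> sx; rewrite -!fE trmxK; apply/cmin/mem_set/AE.
have pminE : pmin M = evalp (quadpoly M) c^T.
  apply/eqP; rewrite eq_le; apply/andP; split.
    apply: ge_inf; last by exists c^T.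
    by exists (evalp (quadpoly M) c^T) => _ [x sx <-]; exact: lb.
  apply: lb_le_inf; first by exists (evalp (quadpoly M) c^T), c^T.
  by move=> _ [x sx <-]; exact: lb.
by rewrite pminE; split; [exists c^T|].
Qed.

(* Main.v *)
(* If p_M - l has a degree-2 certificate, the multiplier of x_j is a sum of
   squares of degree at most 1, hence a constant a_j >= 0; evaluating the
   certificate at x / sum x and homogenising gives
   x^T M x - l (sum x)^2 - (a^T x)(sum x) >= 0, first off the hyperplane
   sum x = 0 and then everywhere by continuity, which is (ii).
   Conversely (ii) says that p_M is convex on that hyperplane.  Let c minimise
   p_M on the simplex and let d = M c - pmin e, which is >= 0 by first-order
   optimality.  With s = sum x and X = (x_1, ..., x_n)^T, symmetry of M and
   c^T M c = pmin give
     p_M - pmin = (X - s c)^T M (X - s c) + 2 d^T X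
                  + (2 d^T X + pmin (s + 1)) (s - 1),
   where the first form is positive semidefinite since X - s c has coordinate
   sum 0, hence a sum of squares.  So pmin itself is feasible. *)
Require Import Defs.
From HB Require Import structures.
From mathcomp Require Import all_boot all_order all_algebra.
From mathcomp Require Import all_classical all_reals all_analysis.
From mathcomp Require Import -(notations) mpoly.
From mathcomp Require Import ring lra.

Set Implicit Arguments.
Unset Strict Implicit.
Unset Printing Implicit Defensive.

Import Order.TTheory GRing.Theory Num.Theory.
Import numFieldNormedType.Exports.

Local Open Scope classical_set_scope.
Local Open Scope ring_scope.

(** * Bilinear forms of matrices *)

Section BilinearForm.
Variables (S : comNzRingType) (n : nat).
Implicit Types (A B : 'M[S]_n) (x y z : 'cV[S]_n).

(** Kept over a general ring because it serves both for real vectors and for the vector of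
    variables. *)
Definition form A x y : S := (x^T *m A *m y) 0 0.

Lemma formBl A x y z : form A (x - y) z = form A x z - form A y z.
Proof. by rewrite /form !linearB /= !mulmxBl !mxE. Qed.

Lemma formZl A t x y : form A (t *: x) y = t * form A x y.
Proof. by rewrite /form linearZ /= -!scalemxAl mxE. Qed.

Lemma formBr A x y z : form A x (y - z) = form A x y - form A x z.
Proof. by rewrite /form mulmxBr !mxE. Qed.

Lemma formZr A t x y : form A x (t *: y) = t * form A x y.
Proof. by rewrite /form -scalemxAr mxE. Qed.

Lemma formD A B x y : form (A + B) x y = form A x y + form B x y.
Proof. by rewrite /form mulmxDr mulmxDl mxE. Qed.

Lemma formB A B x y : form (A - B) x y = form A x y - form B x y.
Proof. by rewrite /form mulmxBr mulmxBl !mxE. Qed.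

Lemma formZ t A x y : form (t *: A) x y = t * form A x y.
Proof. by rewrite /form -scalemxAr -scalemxAl mxE. Qed.

Lemma formC A x y : A^T = A -> form A x y = form A y x.
Proof.
move=> sA; rewrite /form; transitivity ((x^T *m A *m y)^T 0 0).
  by rewrite [RHS]mxE.
by rewrite !trmx_mul trmxK sA mulmxA.
Qed.

Lemma formE A x y : form A x y = \sum_i x i 0 * (A *m y) i 0.
Proof.
by rewrite /form -mulmxA mxE; apply: eq_bigr => i _; rewrite mxE.
Qed.

Lemma form_deltal A i y : form A (delta_mx i 0) y = (A *m y) i 0.
Proof.
rewrite formE (bigD1 i) //= big1 => [|j ji]; rewrite [delta_mx _ _ _ _]mxE.
  by rewrite !eqxx mul1r addr0.
by rewrite (negPf ji) mul0r.
Qed.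

Lemma form_delta A i j : form A (delta_mx i 0) (delta_mx j 0) = A i j.
Proof. by rewrite form_deltal -colE mxE. Qed.

Lemma form_mulmx A B x y : form (B^T *m A *m B) x y = form A (B *m x) (B *m y).
Proof. by rewrite /form trmx_mul !mulmxA. Qed.

Lemma form_rank1 (a b x y : 'cV[S]_n) :
  form (a *m b^T) x y = (\sum_i a i 0 * x i 0) * (\sum_i b i 0 * y i 0).
Proof.
rewrite /form mulmxA -mulmxA mxE big_ord1 !mxE.
by congr (_ * _); apply: eq_bigr => i _; rewrite !mxE // mulrC.
Qed.

End BilinearForm.

(** * Positive semidefinite matrices as sums of rank-one squares *)

Section PsdMatrices.
Variables (R : realType) (n : nat).
Implicit Types (A M : 'M[R]_n) (x y : 'cV[R]_n).

Lemma psd_diag_ge0 A i : psdmx A -> 0 <= A i i.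
Proof. by case=> _ /(_ (delta_mx i 0)); rewrite -/(form _ _ _) form_delta. Qed.

(** With zero diagonal the form at [e_i - t e_j] is linear in [t], so both signs of [t] force its
    slope to vanish. *)
Lemma psd_diag0 A : psdmx A -> (forall i, A i i = 0) -> A = 0.
Proof.
move=> [sA pA] d0; apply/matrixP => i j; rewrite mxE.
have sij : A j i = A i j by rewrite -{1}sA mxE.
have H t : 0 <= - (2 * t * A i j).
  have := pA (delta_mx i 0 - t *: delta_mx j 0).
  rewrite -/(form _ _ _) !(formBl, formBr, formZl, formZr) !form_delta !d0 sij.
  by rewrite (_ : _ - _ = - (2 * t * A i j)) //; ring.
by have := H 1; have := H (-1); lra.
Qed.

(** One step of symmetric Gaussian elimination with pivot [A i i]. *)
Definition elim_mx A i : 'M[R]_n := A - (A i i)^-1 *: (col i A *m (col i A)^T).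

Lemma form_elim A i x : A^T = A ->
  form (elim_mx A i) x x = form A x x - (A i i)^-1 * form A (delta_mx i 0) x ^+ 2.
Proof.
move=> sA; rewrite /elim_mx formB formZ form_rank1 expr2.
rewrite form_deltal; congr (_ - _ * (_ * _)); rewrite mxE; apply: eq_bigr => j _;
  by rewrite mxE -[in LHS]sA mxE.
Qed.

(** The new form at [x] is the form of [A] at [x - t e_i] for the [t] that completes the square. *)
Lemma psd_elim A i : psdmx A -> A i i != 0 -> psdmx (elim_mx A i).
Proof.
move=> [sA pA] Ai; split.
  by rewrite /elim_mx linearB linearZ /= trmx_mul trmxK sA.
move=> x; rewrite -/(form _ _ _) form_elim //.
have := pA (x - ((A i i)^-1 * form A (delta_mx i 0) x) *: delta_mx i 0).
rewrite -/(form _ _ _) !(formBl, formBr, formZl, formZr) form_delta.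
by rewrite (@formC _ _ A x) //; congr (0 <= _); field.
Qed.

(* Eliminating a nonzero diagonal entry clears it and keeps the zero ones, so
   the number of nonzero diagonal entries decreases. *)
Lemma psd_sum_rank1 A : psdmx A ->
  exists s : seq 'rV[R]_n, A = \sum_(w <- s) w^T *m w.
Proof.
have [k] := ubnP #|[set i | A i i != 0]%SET|.
elim: k A => // k IHk A Ak psdA.
have [i Ai|A0] := pickP (fun i => A i i != 0); last first.
  by exists [::]; rewrite big_nil; apply: psd_diag0 => // i; have /eqP := A0 i.
have psdE := psd_elim psdA Ai.
have Ejj j : elim_mx A i j j = A j j - (A i i)^-1 * A j i ^+ 2.
  by rewrite !mxE big_ord1 !mxE expr2.
have [|s Es] := IHk (elim_mx A i) _ psdE.
  apply: leq_trans (Ak : (_ <= k)%N).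
  apply/proper_card/properP; split.
    apply/fintype.subsetP => j; rewrite !inE Ejj; apply: contra => /eqP Aj.
    (* The new entry is minus a nonnegative multiple of a square, yet a diagonal entry of a positive
       semidefinite matrix. *)
    have := psd_diag_ge0 j psdE; rewrite Ejj Aj sub0r oppr_ge0 oppr_eq0 eq_le.
    by move=> -> /=; rewrite mulr_ge0 ?sqr_ge0 // invr_ge0 psd_diag_ge0.
  by exists i; rewrite !inE ?Ai // Ejj negbK subr_eq0 expr2 mulKf.
exists (Num.sqrt (A i i)^-1 *: (col i A)^T :: s).
rewrite big_cons -Es [(_ *: _)^T]linearZ /= trmxK -scalemxAl -scalemxAr scalerA -expr2.
by rewrite sqr_sqrtr ?invr_ge0 ?psd_diag_ge0 // addrC subrK.
Qed.

End PsdMatrices.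

(** * Degrees, sums of squares and affine polynomials *)

Section Polynomials.
Variables (R : realType) (n : nat).
Implicit Types (A M : 'M[R]_n) (p q : {mpoly R[n]}) (x y : 'cV[R]_n).

Definition linpoly (b : 'I_n -> R) : {mpoly R[n]} := \sum_i b i *: mvar i.

Lemma deg_le_mvar i : deg_le (@mvar R n i) 1.
Proof. by rewrite /deg_le /mvar msizeX mdeg1. Qed.

Lemma deg_leC c k : deg_le (mpolyC n (c : R)) k.
Proof. by rewrite /deg_le msizeC; case: eqP. Qed.

Lemma deg_leD p q k : deg_le p k -> deg_le q k -> deg_le (p + q) k.
Proof.
by move=> hp hq; apply: leq_trans (msizeD_le _ _) _; rewrite geq_max hp.
Qed.

Lemma deg_le_sum (I : Type) (r : seq I) (F : I -> {mpoly R[n]}) k :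
  (forall i, deg_le (F i) k) -> deg_le (\sum_(i <- r) F i) k.
Proof.
move=> hF; elim/big_ind: _ => [|p q|i _]; [|exact: deg_leD|exact: hF].
by rewrite /deg_le msize0.
Qed.

Lemma deg_leZ c p k : deg_le p k -> deg_le (c *: p) k.
Proof. by move=> hp; apply: leq_trans (msizeZ_le _ _) hp. Qed.

Lemma deg_leM p q k l : deg_le p k -> deg_le q l -> deg_le (p * q) (k + l).
Proof.
have [->|p0] := eqVneq p 0; first by rewrite mul0r /deg_le msize0.
have [->|q0] := eqVneq q 0; first by rewrite mulr0 /deg_le msize0.
rewrite /deg_le msizeM // => hp hq.
rewrite -ltnS prednK ?addn_gt0 ?lt0n ?msize_poly_eq0 ?p0 //.
by rewrite -addSn -addnS leq_add.
Qed.

Lemma deg_le_linpoly b : deg_le (linpoly b) 1.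
Proof. by apply: deg_le_sum => i; apply/deg_leZ/deg_le_mvar. Qed.

Lemma quadpoly_sum_rank1 (s : seq 'rV[R]_n) :
  quadpoly (\sum_(w <- s) w^T *m w) = \sum_(w <- s) linpoly (w 0) ^+ 2.
Proof.
rewrite /quadpoly raddf_sum mulmx_sumr mulmx_suml summxE.
apply: eq_bigr => w _; rewrite -/(form _ _ _) /= map_mxM.
(* The double transpose produces the shape [a *m b^T] that [form_rank1] expects. *)
rewrite -[X in map_mx _ _ *m map_mx _ X]trmxK.
rewrite -[map_mx _ _^T^T]matrix.map_trmx form_rank1 expr2 /linpoly.
by congr (_ * _); apply: eq_bigr => i _; rewrite !mxE -mul_mpolyC.
Qed.

Lemma sos_quadpoly A : psdmx A -> sos (quadpoly A) /\ deg_le (quadpoly A) 2.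
Proof.
move=> /psd_sum_rank1[s ->]; rewrite quadpoly_sum_rank1; split.
  by exists [seq linpoly (w 0) | w : 'rV[R]_n <- s]; rewrite big_map.
by apply: deg_le_sum => w; rewrite expr2; apply: (@deg_leM _ _ 1 1);
  exact: deg_le_linpoly.
Qed.

Lemma evalp_sos p x : sos p -> 0 <= evalp p x.
Proof.
case=> s ->; rewrite /evalp raddf_sum; apply: sumr_ge0 => q _.
by rewrite /= expr2 mevalM -expr2 sqr_ge0.
Qed.

Lemma deg_le1E p : deg_le p 1 ->
  p = mpolyC n (mcoeff mnm0 p) + linpoly (fun i => mcoeff (mnm1 i) p).
Proof.
move=> p1; apply/mpolyP => m.
rewrite mcoeffD mcoeffC /linpoly raddf_sum /=.
under eq_bigr do rewrite mcoeffZ /mvar mcoeffX.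
have [m1|] := leqP (mdeg m) 1; last first.
  move=> m1; rewrite (memN_msupp_eq0 (msize_mdeg_ge (leq_trans p1 m1))).
  have /negPf -> : m != mnm0 by rewrite -mdeg_eq0 -lt0n ltnW.
  rewrite mulr0 add0r big1 // => i _.
  by case: eqP => [e|]; rewrite ?mulr0 //; move: m1; rewrite -e mdeg1.
move: m1; rewrite leq_eqVlt ltnS leqn0 => /orP[/mdeg1P[i /eqP ->]|].
  rewrite -mdeg_eq0 mdeg1 mulr0 add0r (bigD1 i) //= eqxx mulr1 big1 ?addr0 //.
  by move=> j /negPf ji; rewrite eq_mnm1 ji mulr0.
rewrite mdeg_eq0 => /eqP ->; rewrite eqxx mulr1 big1 ?addr0 // => i _.
by rewrite -mdeg_eq0 mdeg1 mulr0.
Qed.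

(** An affine function that is nonnegative along every coordinate axis has zero slopes. *)
Lemma sos_deg1_const p : sos p -> deg_le p 1 ->
  exists2 c, 0 <= c & p = mpolyC n c.
Proof.
move=> sp /deg_le1E pE.
have ev x : evalp p x = mcoeff mnm0 p + \sum_i mcoeff (mnm1 i) p * x i 0.
  rewrite /evalp [in LHS]pE mevalD mevalC /linpoly raddf_sum.
  by congr (_ + _); apply: eq_bigr => i _; rewrite /= mevalZ mevalXU.
have c0 : 0 <= mcoeff mnm0 p.
  have := evalp_sos 0 sp; rewrite ev big1 ?addr0 // => i _.
  by rewrite mxE mulr0.
exists (mcoeff mnm0 p) => //; rewrite [LHS]pE /linpoly big1 ?addr0 // => i _.
suff -> : mcoeff (mnm1 i) p = 0 by rewrite scale0r.
have line t : 0 <= mcoeff mnm0 p + t * mcoeff (mnm1 i) p.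
  have := evalp_sos (t *: delta_mx i 0) sp; rewrite ev (bigD1 i) //= big1.
    by rewrite !mxE !eqxx mulr1 addr0 mulrC.
  by move=> j ji; rewrite !mxE (negPf ji) !mulr0.
apply/eqP/negPn/negP => l0.
(* At this [t] the affine function takes the value -1. *)
by have := line (- (mcoeff mnm0 p + 1) / mcoeff (mnm1 i) p); rewrite divfK //; lra.
Qed.

End Polynomials.

(** * From certificates to positive semidefiniteness *)

Section Certificates.
Variables (R : realType) (n : nat).
Implicit Types (M : 'M[R]_n) (x y : 'cV[R]_n) (l : R).

(** The matrix of (ii). *)
Definition shifted M l (a : 'cV[R]_n) :=
  M - l *: (ones *m ones^T) - 2^-1 *: (a *m ones^T + ones *m a^T).

Lemma form_shifted M l a x : form (shifted M l a) x x =
  form M x x - l * (\sum_i x i 0) ^+ 2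
  - (\sum_i a i 0 * x i 0) * (\sum_i x i 0).
Proof.
rewrite /shifted !formB !formZ formD !form_rank1.
have -> : \sum_i ones i 0 * x i 0 = \sum_i x i 0.
  by apply: eq_bigr => i _; rewrite mxE mul1r.
by field.
Qed.

Lemma shifted_sym M l a : M^T = M -> (shifted M l a)^T = shifted M l a.
Proof.
move=> sM; apply/matrixP => i j.
rewrite !mxE !big_ord1 !mxE -[in M j i]sM mxE; ring.
Qed.

(** On the hyperplane of coordinate sum 1 the ideal term vanishes, and the free sum of squares only
    adds a nonnegative amount. *)
Lemma feasible1_eval M l : feasible1 M l ->
  exists2 a : 'cV[R]_n, (forall i, 0 <= a i 0) &
  forall y, \sum_i y i 0 = 1 -> l + \sum_i a i 0 * y i 0 <= form M y y.
Proof.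
case=> _ [_ [[s0 [s [[sos0 soss] _ sdeg ->]]] [u _ ->] e]].
have /choice[c cP] j : exists c, 0 <= c /\ s j = mpolyC n c.
  have [c c0 cE] : exists2 c, 0 <= c & s j = mpolyC n c; last by exists c.
  apply: sos_deg1_const => //; have := sdeg j.
  (* The size of a product is known for nonzero factors; there the bound 2 on [s j * mvar j] leaves
     degree at most 1 for [s j]. *)
  have [->|s_n0] := eqVneq (s j) 0; first by rewrite /deg_le msize0.
  have m_n0 : @mvar R n j != 0 by rewrite -msize_poly_eq0 msizeX.
  by rewrite /deg_le msizeM // /mvar msizeX mdeg1 addn2.
exists (\col_i c i) => [i|y y1]; first by rewrite mxE; have [] := cP i.
have := congr1 (meval (fun i => y i 0)) e; rewrite !(mevalB, mevalD, mevalM) mevalC.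
rewrite -!/(evalp _ y) evalp_quadpoly -/(form _ _ _).
have -> : evalp (\sum_i mvar i) y = 1 :> R.
  by rewrite -y1 /evalp raddf_sum; apply: eq_bigr => i _; rewrite /= mevalXU.
have -> : evalp 1 y = 1 :> R by rewrite /evalp rmorph1.
have -> : evalp (\sum_j s j * mvar j) y = \sum_i (\col_i c i) i 0 * y i 0.
  rewrite /evalp raddf_sum; apply: eq_bigr => i _.
  by rewrite /= mevalM mevalXU mxE (cP i).2 mevalC.
by rewrite subrr mulr0; have := evalp_sos y sos0; lra.
Qed.

(** The limit [t -> 0] done algebraically: adding the inequalities at [t] and [-t] cancels [B] and
    leaves [F + t^2 D >= 0]. *)
Lemma quad_ge0_at0 (F B D : R) :
  (forall t, t != 0 -> 0 <= F - 2 * t * B + t ^+ 2 * D) -> 0 <= F.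
Proof.
move=> quad; rewrite leNgt; apply/negP => F0.
have E0 : 0 < `|D| + 1 by rewrite ltr_wpDl.
set E := `|D| + 1 in E0.
(* [u] is the value of [t^2], chosen so that [u * D <= - F / 2], whence [F + u * D < 0]. *)
pose u := - F / (2 * E); have u0 : 0 < u by rewrite divr_gt0 ?mulr_gt0 ?oppr_gt0.
have t0 : Num.sqrt u != 0 by rewrite gt_eqF ?sqrtr_gt0.
have := quad _ t0; have := quad (- Num.sqrt u); rewrite oppr_eq0 => /(_ t0).
rewrite sqrrN sqr_sqrtr ?(ltW u0) // => quadN quadP.
have uD : u * D <= u * E by rewrite ler_pM2l // /E; have := ler_norm D; lra.
have uE : u * E = - F / 2 by rewrite /u; field; rewrite gt_eqF.
lra.
Qed.

Lemma psd_of_feasible1 M l : (0 < n)%N -> M^T = M -> feasible1 M l ->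
  exists2 a : 'cV[R]_n, (forall i, 0 <= a i 0) & psdmx (shifted M l a).
Proof.
move=> n_gt0 sM /feasible1_eval[a a0 aP]; exists a => //.
split; [exact: shifted_sym|move=> x; rewrite -/(form _ _ _)].
have off y : \sum_i y i 0 != 0 -> 0 <= form (shifted M l a) y y.
  move=> y0; set t := \sum_i y i 0 in y0.
  have := aP (t^-1 *: y); rewrite formZl formZr.
  have -> : \sum_i (t^-1 *: y) i 0 = 1.
    by under eq_bigr do rewrite mxE; rewrite -mulr_sumr mulVf.
  have -> : \sum_i a i 0 * (t^-1 *: y) i 0 = t^-1 * \sum_i a i 0 * y i 0.
    by rewrite mulr_sumr; apply: eq_bigr => i _; rewrite mxE mulrCA.
  move/(_ erefl); rewrite form_shifted -/t -subr_ge0.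
  move/(mulr_ge0 (sqr_ge0 t)); congr (0 <= _); field => //.
have [x0|] := eqVneq (\sum_i x i 0) 0; last exact: off.
(* Moving along a direction of coordinate sum 1 leaves the hyperplane of sum 0 for every
   [t != 0]. *)
have [d sd] : exists d : 'cV[R]_n, \sum_i d i 0 = 1.
  exists (delta_mx (Ordinal n_gt0) 0).
  rewrite (bigD1 (Ordinal n_gt0)) //= big1 => [|i /negPf i0]; rewrite mxE.
    by rewrite !eqxx addr0.
  by rewrite i0.
have near0 (t : R) : t != 0 -> 0 <= form (shifted M l a) (x - t *: d) (x - t *: d).
  move=> t0; apply: off.
  under eq_bigr do rewrite !mxE.
  by rewrite big_split /= x0 add0r sumrN -mulr_sumr sd mulr1 oppr_eq0.
apply: (@quad_ge0_at0 _ (form (shifted M l a) d x) (form (shifted M l a) d d)).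
move=> t /near0; rewrite !(formBl, formBr, formZl, formZr).
by rewrite (formC x d) ?shifted_sym //; congr (0 <= _); ring.
Qed.

Lemma feasible1_le M l : (0 < n)%N -> feasible1 M l -> l <= pmin M.
Proof.
move=> n_gt0 /feasible1_eval[a a0 aP].
have [[x [x0 x1] <-] _] := pmin_is_min M n_gt0.
rewrite evalp_quadpoly -/(form _ _ _); apply: le_trans (aP x x1).
by rewrite lerDl; apply: sumr_ge0 => i _; rewrite mulr_ge0.
Qed.

End Certificates.

(** * Optimality on the simplex and the certificate for [pmin] *)

Section Optimality.
Variables (R : realType) (n : nat).
Implicit Types (M : 'M[R]_n) (c x y : 'cV[R]_n).

Lemma simplex_delta i : simplex (delta_mx i 0 : 'cV[R]_n).
Proof.
split=> [j|]; first by rewrite mxE; case: (_ && _).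
rewrite (bigD1 i) //= big1 => [|j /negPf ji]; rewrite mxE ?ji //.
by rewrite !eqxx addr0.
Qed.

Lemma simplex_segment x y t : 0 <= t <= 1 -> simplex x -> simplex y ->
  simplex (x - t *: (x - y)).
Proof.
move=> /andP[t0 t1] [x0 x1] [y0 y1].
have E i : (x - t *: (x - y)) i 0 = (1 - t) * x i 0 + t * y i 0.
  by rewrite !mxE; ring.
split=> [i|]; first by rewrite E addr_ge0 // mulr_ge0 // subr_ge0.
under eq_bigr do rewrite E.
by rewrite big_split /= -!mulr_sumr x1 y1; ring.
Qed.

(** Otherwise a short move from [c] towards the vertex [e_i] would decrease the form. *)
Lemma simplex_min_KKT M c i : M^T = M -> simplex c ->
  (forall x, simplex x -> form M c c <= form M x x) ->
  form M c c <= (M *m c) i 0.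
Proof.
move=> sM sc cmin; rewrite leNgt; apply/negP => lt_ic.
set p := form M c c in cmin lt_ic.
(* Known only through an equation, [d] stays whole when the forms are expanded by bilinearity. *)
have [d dE] : exists d, d = c - delta_mx i 0 by eexists.
pose D := form M d d.
have [g g0 gE] : exists2 g, 0 < g & form M c d = g.
  exists (p - (M *m c) i 0); first by rewrite subr_gt0.
  by rewrite dE formBr (formC c) // form_deltal.
have cmin_t t : 0 <= t <= 1 -> 0 <= - (2 * t * g) + t ^+ 2 * D.
  move=> t01; have := cmin _ (simplex_segment t01 sc (simplex_delta i)).
  rewrite -dE !(formBl, formBr, formZl, formZr) (formC d c) // gE -/p -/D.
  by rewrite -subr_ge0; congr (0 <= _); ring.
have E0 : 0 < `|D| + g by rewrite ltr_wpDl.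
(* This step lies in (0, 1] and gives [t * D <= t * |D| = g - t * g < 2 * g]. *)
pose t := g / (`|D| + g).
have t0 : 0 < t by rewrite divr_gt0.
have t1 : t <= 1 by rewrite ler_pdivrMr // mul1r lerDr.
have := cmin_t t; rewrite (ltW t0) t1 => /(_ isT).
have tE : t * (`|D| + g) = g by rewrite divfK // gt_eqF.
have -> : - (2 * t * g) + t ^+ 2 * D = t * (t * D - 2 * g) by ring.
rewrite pmulr_rge0 //.
have tD : t * D <= t * `|D| by rewrite ler_pM2l // ler_norm.
have tg : 0 < t * g by rewrite mulr_gt0.
move: tE; rewrite mulrDr; lra.
Qed.

(** When [c] has coordinate sum 1, this is the projection along [c] onto the vectors of sum 0. *)
Definition centering c : 'M[R]_n := 1%:M - c *m ones^T.

Lemma centeringE c y : centering c *m y = y - (\sum_i y i 0) *: c.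
Proof.
rewrite mulmxBl mul1mx -mulmxA [ones^T *m y]mx11_scalar mul_mx_scalar mxE.
by congr (_ - _ *: _); apply: eq_bigr => k _; rewrite !mxE mul1r.
Qed.

(** Centred vectors have coordinate sum 0, where the form of [shifted M l a] agrees with that of
    [M]. *)
Lemma psd_centering M l a c : psdmx (shifted M l a) -> M^T = M ->
  \sum_i c i 0 = 1 -> psdmx ((centering c)^T *m M *m centering c).
Proof.
move=> [_ pM] sM c1; split; first by rewrite !trmx_mul trmxK sM mulmxA.
move=> y; rewrite -/(form _ _ _) form_mulmx centeringE.
set z := _ - _; have z0 : \sum_i z i 0 = 0.
  under eq_bigr do rewrite !mxE.
  by rewrite big_split /= sumrN -mulr_sumr c1 mulr1 subrr.
by have := pM z; rewrite -/(form _ _ _) form_shifted z0; congr (0 <= _); ring.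
Qed.

(** Moves the square part of the certificate to the polynomial ring, where bilinearity expands
    it. *)
Lemma quadpoly_centering M c :
  let s : {mpoly R[n]} := \sum_i mvar i in
  let X : 'cV_n := \col_i mvar i in
  let C := map_mx (@mpolyC n R) c in
  quadpoly ((centering c)^T *m M *m centering c) =
  form (map_mx (@mpolyC n R) M) (X - s *: C) (X - s *: C).
Proof.
move=> s X C; rewrite /quadpoly -/X -/(form _ _ _) !map_mxM -matrix.map_trmx.
rewrite form_mulmx.
suff -> : map_mx (@mpolyC n R) (centering c) *m X = X - s *: C by [].
rewrite map_mxB map_mxM map_mx1 mulmxBl mul1mx -mulmxA.
rewrite [map_mx _ ones^T *m X]mx11_scalar mul_mx_scalar mxE.
by congr (_ - _ *: _); apply: eq_bigr => k _; rewrite !mxE rmorph1 mul1r.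
Qed.

Lemma feasible1_pmin M l a : (0 < n)%N -> M^T = M ->
  psdmx (shifted M l a) -> feasible1 M (pmin M).
Proof.
move=> n_gt0 sM psdS.
have [[c sc cp] pmin_le] := pmin_is_min M n_gt0.
have [c0 c1] := sc.
rewrite evalp_quadpoly -/(form _ _ _) in cp; set p := pmin M in cp pmin_le *.
pose d i := (M *m c) i 0 - p.
have d0 i : 0 <= d i.
  rewrite subr_ge0 -cp; apply: simplex_min_KKT => // x sx.
  by have := pmin_le x sx; rewrite evalp_quadpoly cp.
have [sos0 deg0] := sos_quadpoly (psd_centering psdS sM c1).
pose s : {mpoly R[n]} := \sum_i mvar i.
have s_deg : deg_le s 1 by apply: deg_le_sum => i; exact: deg_le_mvar.
pose u := linpoly (fun i => 2 * d i) + p *: (s + 1).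
exists (quadpoly ((centering c)^T *m M *m centering c)
        + \sum_i mpolyC n (2 * d i) * mvar i), (u * (s - 1)); split.
- exists (quadpoly ((centering c)^T *m M *m centering c)),
    (fun i => mpolyC n (2 * d i)).
  split=> // [|i].
    split=> // i; exists [:: mpolyC n (Num.sqrt (2 * d i))].
    by rewrite big_seq1 -rmorphXn /= sqr_sqrtr // mulr_ge0.
  by rewrite mul_mpolyC; apply/deg_leZ/(leq_trans (deg_le_mvar _ _)).
- exists u => //; rewrite -[2%N]/(1 + 1)%N; apply: deg_leM.
    apply: deg_leD; first exact: deg_le_linpoly.
    by apply/deg_leZ/deg_leD => //; rewrite -mpolyC1; exact: deg_leC.
  by apply: deg_leD => //; rewrite -mpolyC1 -mpolyCN; exact: deg_leC.
rewrite quadpoly_centering -/s.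
set X : 'cV_n := \col_i mvar i; set C := map_mx _ c; set F := map_mx _ M.
have sF : F^T = F by rewrite matrix.map_trmx sM.
have FCC : form F C C = mpolyC n p.
  rewrite /form matrix.map_trmx -!map_mxM mxE; congr mpolyC; exact: cp.
have sumd : \sum_i mpolyC n (2 * d i) * mvar i = linpoly (fun i => 2 * d i).
  by apply: eq_bigr => i _; rewrite mul_mpolyC.
(* This is [M c = d + p e] paired with [X]. *)
have FXC : form F X C = mpolyC n p * s + linpoly d.
  rewrite formE -map_mxM mulr_sumr -big_split; apply: eq_bigr => i _ /=.
  by rewrite mxE [map_mx _ _ _ _]mxE mulrC -mul_mpolyC -mulrDl -mpolyCD /d subrKC.
have lin2 : linpoly (fun i => 2 * d i) = 2 * linpoly d.
  by rewrite mulr_sumr; apply: eq_bigr => i _; rewrite -scalerA scaler_nat mulr_natl.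
(* With [L = linpoly d], the square part becomes [p_M - 2 s L - p s^2]; the other terms add up to
   [2 s L + p (s^2 - 1)]. *)
rewrite !(formBl, formBr, formZl, formZr) (formC C X) // FXC FCC sumd lin2.
rewrite /u lin2 -mul_mpolyC -/X -[quadpoly M]/(form F X X).
ring.
Qed.

End Optimality.

(** Assertion (i) enters twice, as feasibility and as finiteness: any feasible value bounds the
    supremum below, [pmin M] bounds it above, and an empty program has value [-oo]. *)
Theorem lemma3p1 (R : realType) (n : nat) (M : 'M[R]_n)
    (n_gt0 : (0 < n)%N) (M_sym : M^T = M) :
  [<-> feasible1 M !=set0;
       pM1 M \is a fin_num;
       exists (l : R) (a : 'cV[R]_n), (forall i, 0 <= a i 0) /\
         psdmx (M - l *: (ones *m ones^T)
                - 2^-1 *: (a *m ones^T + ones *m a^T));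
       pM1 M = (pmin M)%:E].
Proof.
have pM1_le : (pM1 M <= (pmin M)%:E)%E.
  by apply: ge_ereal_sup => _ [l /(feasible1_le n_gt0) lp <-]; rewrite lee_fin.
have pM1_feasible : pM1 M != -oo%E -> feasible1 M !=set0.
  move=> fin; apply/set0P; apply: contra fin => /eqP f0.
  by rewrite /pM1 f0 image_set0 ereal_sup0.
tfae.
- case=> l fl; rewrite fin_numE; apply/andP; split.
    rewrite -ltNye; apply: lt_le_trans (ltNyr l) _.
    by apply: ereal_sup_ubound; exists l.
  by rewrite -ltey; apply: le_lt_trans pM1_le (ltry _).
- rewrite fin_numE => /andP[/pM1_feasible[l fl] _].
  by have [a a0 psda] := psd_of_feasible1 n_gt0 M_sym fl; exists l, a.
- case=> l [a [_ psda]]; apply/eqP; rewrite eq_le pM1_le /=.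
  by apply: ereal_sup_ubound; exists (pmin M) => //; exact: feasible1_pmin psda.
- by move=> E; apply: pM1_feasible; rewrite E.
Qed.
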